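(* Let $p$ be a prime. Every generalized Cayley graph of order $2p$ (that is, every generalized Cayley graph $GC(G,S,\alpha)$ on a group $G$ of order $2p$) is a Cayley graph.
   Context: Let $G$ be a group, $S\subseteq G$ and $\alpha\in\mathrm{Aut}(G)$ such that: (i) $\alpha^2=1$; (ii) $\alpha(x^{-1})x\notin S$ for every $x\in G$; (iii) for all $x,y\in G$, if $\alpha(x^{-1})y\in S$ then $\alpha(y^{-1})x\in S$ (given (i), this is equivalent to $\alpha(S^{-1})=S$). The generalized Cayley graph $GC(G,S,\alpha)$ is the (simple, undirected) graph with vertex set $G$ in which $x,y$ are adjacent iff $\alpha(x^{-1})y\in S$. If $\alpha=1$ it is called a Cayley graph and denoted $\mathrm{Cay}(G,S)$. A graph ''is a Cayley graph'' if it is isomorphic to $\mathrm{Cay}(H,T)$ for some group $H$ (not necessarily the given group $G$) and some admissible $T\subseteq H$. *)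

(* Defs.v *)
From HB Require Import structures.
From mathcomp Require Import all_boot all_fingroup.

Set Implicit Arguments.
Unset Strict Implicit.
Unset Printing Implicit Defensive.

Local Open Scope group_scope.

(* A group G is represented by the finGroupType gT of all its elements; a
   simple graph is a symmetric irreflexive relation on a finType (see
   gcay_sym and gcay_irr for the graphs defined here). *)

Definition gcay_admissible (gT : finGroupType) (S : {set gT})
    (alpha : {perm gT}) : Prop :=
  [/\ alpha \in Aut [set: gT],
      alpha ^+ 2 = 1,
      forall x, alpha x^-1 * x \notin S
    & forall x y, alpha x^-1 * y \in S -> alpha y^-1 * x \in S].

Definition gcay (gT : finGroupType) (S : {set gT}) (alpha : {perm gT}) :
  rel gT := fun x y => alpha x^-1 * y \in S.

Definition cay_admissible (gT : finGroupType) (T : {set gT}) : Prop :=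
  gcay_admissible T 1.

Definition cay (gT : finGroupType) (T : {set gT}) : rel gT := gcay T 1.

Definition graph_iso (V W : finType) (e : rel V) (e' : rel W) : Prop :=
  exists2 f : V -> W, bijective f & forall x y, e' (f x) (f y) = e x y.

Definition is_cayley_graph (V : finType) (e : rel V) : Prop :=
  exists (hT : finGroupType) (T : {set hT}),
    cay_admissible T /\ graph_iso e (cay T).

Lemma gcay_irr (gT : finGroupType) (S : {set gT}) (alpha : {perm gT}) :
  gcay_admissible S alpha -> irreflexive (gcay S alpha).
Proof. by case=> _ _ irrS _ x; apply/negbTE/irrS. Qed.

Lemma gcay_sym (gT : finGroupType) (S : {set gT}) (alpha : {perm gT}) :
  gcay_admissible S alpha -> symmetric (gcay S alpha).
Proof. by case=> _ _ _ symS x y; apply/idP/idP; apply: symS. Qed.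

Lemma cayE (gT : finGroupType) (T : {set gT}) x y :
  cay T x y = (x^-1 * y \in T).
Proof. by rewrite /cay /gcay perm1. Qed.

(* Main.v *)
Require Import Defs.
From HB Require Import structures.
From mathcomp Require Import all_boot all_fingroup.
From mathcomp Require Import ssralg finalg zmodp pgroup cyclic.

(** Let [alpha <> 1].  Then [G] has a cyclic subgroup [N = <[a]>] of index two
    that [alpha] inverts and all of whose elements are of the form
    [alpha x^-1 * x], so that [N] is disjoint from [S]: for odd [p] it is the
    subgroup of order [p] (were it fixed by [alpha], then [alpha] would be
    trivial), and for [p = 2] any [alpha x^-1 * x <> 1] generates it.
    Hence all edges of the graph join [N] to its complement [N c], and since
    [alpha] inverts [N], [a^i] is adjacent to [a^j c] iff [a^(i+j) c \in S].
    Such a bipartite "sum graph" is a Cayley graph of the generalized dihedral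
    group of [N]. *)

Set Implicit Arguments.
Unset Strict Implicit.
Unset Printing Implicit Defensive.

Import GRing.Theory.

Local Open Scope group_scope.

(* [(b, x)] stands for [s^b x], where the involution [s] inverts [A]. *)
Definition gen_dihedral (A : finZmodType) : Type := (bool * A)%type.

Section GenDihedral.
Variable A : finZmodType.
Implicit Types u v : gen_dihedral A.
Local Open Scope ring_scope.

HB.instance Definition _ := Finite.copy (gen_dihedral A) (bool * A)%type.

Definition gdih_one : gen_dihedral A := (false, 0).
Definition gdih_mul u v : gen_dihedral A :=
  (u.1 (+) v.1, (if v.1 then - u.2 else u.2) + v.2).
Definition gdih_inv u : gen_dihedral A := (u.1, if u.1 then u.2 else - u.2).

Lemma gdih_mulA : associative gdih_mul.
Proof.
move=> [b x] [c y] [d z]; rewrite /gdih_mul /= addbA; congr (_, _).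
by case: c d => [] []; rewrite /= ?opprD ?opprK ?addrA.
Qed.

Lemma gdih_mul1 : left_id gdih_one gdih_mul.
Proof. by move=> [b x]; rewrite /gdih_mul /= oppr0 if_same add0r. Qed.

Lemma gdih_mulV : left_inverse gdih_one gdih_inv gdih_mul.
Proof.
by move=> [[] x]; rewrite /gdih_mul /gdih_one /= addNr.
Qed.

HB.instance Definition _ :=
  Finite_isGroup.Build (gen_dihedral A) gdih_mulA gdih_mul1 gdih_mulV.

End GenDihedral.

Lemma gdih_divE (A : finZmodType) (u v : gen_dihedral A) :
  u^-1 * v =
  (u.1 (+) v.1, if u.1 (+) v.1 then u.2 + v.2 else v.2 - u.2)%R.
Proof.
rewrite -[LHS]/(gdih_mul (gdih_inv u) v) /gdih_mul /gdih_inv.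
case: u v => [b x] [d y] /=.
by case: b d => [] []; rewrite /= ?opprK // addrC.
Qed.

(** Since [s] inverts [A], the inverse of [s^b x] times [s^d y] with [b] and [d] different has
    [A]-part [x + y]. The connection set [T'] is thus [s T], which consists of involutions. *)
Lemma sum_graph_cayley (A : finZmodType) (T : {set A}) (V : finType)
    (e : rel V) (f : gen_dihedral A -> V) :
  bijective f ->
  (forall u v, e (f u) (f v) = (u.1 (+) v.1) && (u.2 + v.2 \in T)%R) ->
  is_cayley_graph e.
Proof.
move=> [g fK gK] ef.
pose T' : {set gen_dihedral A} := [set u : gen_dihedral A | u.1 && (u.2 \in T)].
have T'E (u v : gen_dihedral A) :
    (u^-1 * v \in T') = (u.1 (+) v.1) && (u.2 + v.2 \in T)%R.
  by rewrite gdih_divE inE /=; case: ifP.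
exists (gen_dihedral A), T'; split; last first.
  by exists g => [|x y]; [exists f | rewrite cayE T'E -ef !gK].
split; first exact: group1.
- by rewrite expg1n.
- by move=> u; rewrite perm1 T'E addbb.
- by move=> u v; rewrite !perm1 !T'E addbC addrC.
Qed.

Section IndexTwo.
Variables (gT : finGroupType) (N : {group gT}).
Hypothesis iN : #|gT| = (2 * #|N|)%N.

Lemma index2_divl x y : x \notin N -> y \notin N -> x^-1 * y \in N.
Proof.
move=> Nx Ny; rewrite -mem_lcoset.
have dis : [disjoint N & x *: N].
  rewrite disjoint_sym disjoints_subset; apply/subsetP=> _ /lcosetP[z Nz ->].
  by rewrite inE groupMr.
have : N :|: x *: N == setT.
  rewrite eqEcard subsetT cardsT iN (cardsU N) (disjoint_setI0 dis) cards0.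
  by rewrite card_lcoset subn0 mul2n addnn leqnn.
by move=> /eqP/setP/(_ y); rewrite !inE (negPf Ny).
Qed.

Lemma index2_sqr x : x ^+ 2 \in N.
Proof.
have [Nx|Nx] := boolP (x \in N); first by rewrite groupX.
by rewrite expgS expg1 -{1}[x]invgK index2_divl ?groupV.
Qed.

Lemma index2_exists_notin : exists c, c \notin N.
Proof.
apply/existsP; rewrite -negb_forall; apply/negP=> /forallP allN.
have : #|N| < #|gT| by rewrite iN ltn_Pmull ?cardG_gt0.
by rewrite -cardsT ltnNge subset_leq_card //; apply/subsetP=> x _.
Qed.

End IndexTwo.

Section Automorphism.
Variables (gT : finGroupType) (alpha : {perm gT}).
Hypothesis Aalpha : alpha \in Aut [set: gT].

Lemma autM : {morph alpha : x y / x * y}.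
Proof. by move=> x y; apply: (morphicP (Aut_morphic Aalpha)); rewrite inE. Qed.

Lemma aut1 : alpha 1 = 1.
Proof. by apply: (mulgI (alpha 1)); rewrite -autM !mulg1. Qed.

Lemma autV : {morph alpha : x / x^-1}.
Proof. by move=> x; apply: (mulgI (alpha x)); rewrite -autM !mulgV aut1. Qed.

Lemma autX n : {morph alpha : x / x ^+ n}.
Proof.
by move=> x; elim: n => [|n IHn]; rewrite ?aut1 // !expgS autM IHn.
Qed.

End Automorphism.

Lemma inverted_cycle_cayley (gT : finGroupType) (S : {set gT})
    (alpha : {perm gT}) (a : gT) :
  gcay_admissible S alpha -> #|gT| = (2 * #[a])%N -> alpha a = a^-1 ->
  (forall x, x \in <[a]> -> x \notin S) -> is_cayley_graph (gcay S alpha).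
Proof.
move=> hS iN alphaa NS; have [Aalpha _ _ _] := hS.
have [c Nc] := index2_exists_notin iN.
have alphaX i : alpha (a ^+ i) = a ^- i by rewrite autX // alphaa expgVn.
have alphac : alpha c \notin <[a]>.
  apply: contra Nc => /cycleP[i ci].
  suff -> : c = a ^- i by rewrite groupV mem_cycle.
  by apply: (@perm_inj _ alpha); rewrite autV // alphaX invgK.
(* This is the group of integers modulo [#[a]]; the successor form of the bound, harmless since
   [#[a] > 0], gives the ordinals their additive structure. *)
pose A := 'I_#[a].-1.+1.
have cA : #|A| = #[a] by rewrite card_ord prednK ?order_gt0.
have aX0 : a ^+ #[a].-1.+1 = 1 by rewrite prednK ?order_gt0 ?expg_order.
have aD (i j : A) : a ^+ (i + j)%R = a ^+ i * a ^+ j.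
  by rewrite -expgD /= expg_mod.
(* Only a bijection of vertices, in general not a group morphism. *)
pose f (u : gen_dihedral A) : gT := if u.1 then a ^+ u.2 * c else a ^+ u.2.
have fN u : (f u \in <[a]>) = ~~ u.1.
  by rewrite /f; case: ifP => _; rewrite ?groupMl ?mem_cycle // (negPf Nc).
have aI (i j : A) : a ^+ i = a ^+ j -> i = j.
  move=> /eqP; rewrite eq_expg_mod_order !modn_small => [/eqP/val_inj||] //;
    by rewrite -{2}(prednK (order_gt0 a)).
have fI : injective f.
  move=> [b i] [d j] fE; have := fN (b, i); rewrite fE fN /= => /negb_inj db.
  by move: fE; rewrite /f /= -db; case: d {db} => [/mulIg|] /aI ->.
have f_bij : bijective f.
  by apply: inj_card_bij => //; rewrite card_prod card_bool cA iN.
pose T := [set i : A | a ^+ i * c \in S].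
have alphaV u :
    alpha (f u)^-1 = if u.1 then (alpha c)^-1 * a ^+ u.2 else a ^+ u.2.
  by rewrite autV // /f; case: ifP; rewrite ?autM // alphaX ?invMg invgK.
apply: (sum_graph_cayley (T := T) f_bij) => -[b i] [d j] /=.
have e01 x y : gcay S alpha (f (false, x)) (f (true, y)) = ((x + y)%R \in T).
  by rewrite /gcay alphaV /f /= mulgA -aD inE.
case: b d => [] [] /=.
(* Neither [alpha c] nor [c] is in [<[a]>], so with index two the quotient of two vertices in this
   coset lies in [<[a]>]. *)
- apply/negbTE/NS; rewrite alphaV /f /= -mulgA (mulgA (a ^+ i)) -expgD.
  by rewrite index2_divl // groupMl // mem_cycle.
- by rewrite gcay_sym // e01 addrC.
- exact: e01.
by apply/negbTE/NS; rewrite alphaV /f /= -expgD mem_cycle.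
Qed.

Lemma involution_inverts_diff (gT : finGroupType) (alpha : {perm gT}) x :
  alpha \in Aut [set: gT] -> alpha ^+ 2 = 1 ->
  alpha (alpha x^-1 * x) = (alpha x^-1 * x)^-1.
Proof.
move=> Aalpha /permP/(_ x^-1); rewrite permX /= perm1 => alphaK.
by rewrite autM // alphaK invMg autV // invgK.
Qed.

Lemma inverted_cycle_order4 (gT : finGroupType) (S : {set gT})
    (alpha : {perm gT}) :
  gcay_admissible S alpha -> #|gT| = 4 -> alpha != 1 ->
  exists a, [/\ #[a] = 2, alpha a = a^-1 & forall x, x \in <[a]> -> x \notin S].
Proof.
move=> [Aalpha alpha2 irrS _] c4 n1.
have /existsP[x nx] : [exists x, alpha x != x].
  rewrite -negb_forall; apply: contra n1 => /forallP fx.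
  by apply/eqP/permP=> x; rewrite perm1; apply/eqP/fx.
set z := alpha x^-1 * x.
have alphaz : alpha z = z^-1 by apply: involution_inverts_diff.
have z1 : z != 1.
  by apply: contra nx; rewrite /z autV // -eq_mulVg1.
have z2 : z ^+ 2 = 1.
  have : #[z] %| 4 by rewrite -c4 -cardsT order_dvdG ?inE.
  case/(@dvdn_pfactor 2 _ 2 isT)=> // -[|[|[|//]]] _ oz.
  - by move/eqP: oz z1; rewrite order_eq1 => ->.
  - by apply/eqP; rewrite -order_dvdn oz.
  (* If [z] had order 4, [alpha] would invert all of [G]; then [z = x ^+ 2], whence
     [z ^+ 2 = x ^+ 4 = 1]. *)
  have zT : <[z]> = setT.
    by apply/eqP; rewrite eqEcard subsetT cardsT c4 -orderE oz.
  have /cycleP[k xz] : x \in <[z]> by rewrite zT inE.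
  have zx : z = x ^+ 2.
    by rewrite {1}/z autV // {1}xz autX // alphaz expgVn -xz invgK.
  rewrite zx -expgM; apply/eqP; rewrite -order_dvdn -[(2 * 2)%N]c4 -cardsT.
  by rewrite order_dvdG ?inE.
have oz : #[z] = 2 by apply: nt_prime_order.
exists z; split=> // y.
(* The two elements [1] and [z] of [<[z]>] are the values of [alpha y^-1 * y] at [y = 1] and
   [y = x]. *)
rewrite cycle2g // !inE => /pred2P[]->; last exact: irrS.
by have := irrS 1; rewrite mulg1 invg1 aut1.
Qed.

Lemma inverted_cycle_odd (p : nat) (gT : finGroupType) (S : {set gT})
    (alpha : {perm gT}) :
  prime p -> odd p ->
  gcay_admissible S alpha -> #|gT| = (2 * p)%N -> alpha != 1 ->
  exists a, [/\ #[a] = p, alpha a = a^-1 & forall x, x \in <[a]> -> x \notin S].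
Proof.
move=> hp odd_p [Aalpha alpha2 irrS _] cG n1.
have alphaK x : alpha (alpha x) = x.
  by have /permP/(_ x) := alpha2; rewrite permX perm1.
have [a _ oa] : {a | a \in [set: gT] & #[a] = p}.
  by apply: Cauchy; rewrite // cardsT cG dvdn_mull.
have iN : #|gT| = (2 * #|<[a]>|)%N by rewrite -orderE oa.
have sqr_root (x : gT) : x ^+ p = 1 -> exists k, x = (x ^+ k) ^+ 2.
  (* As [p] is odd, twice this exponent is [p + 1]. *)
  move=> xp; exists p.+1./2.
  by rewrite -expgM mulnC mul2n even_halfK ?odd_p //= ?odd_p // expgS xp mulg1.
have powp x : x \in <[a]> -> x ^+ p = 1.
  by case/cycleP=> i ->; rewrite -expgM mulnC expgM -oa expg_order expg1n.
(* The order of [alpha a] divides [p], so [alpha a] is a square, and squares lie in a subgroup of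
   index two. *)
have Na : alpha a \in <[a]>.
  have [|k ->] := sqr_root (alpha a); last exact: index2_sqr.
  by rewrite -autX // -oa expg_order aut1.
have NalphaN x : x \in <[a]> -> alpha x \in <[a]>.
  by case/cycleP=> i ->; rewrite autX // groupX.
have alphaa : alpha a = a^-1.
  (* The involution [alpha] swaps the two commuting factors of [w], hence fixes [w]. If [w != 1],
     then [w] generates [<[a]>], which is therefore fixed pointwise. *)
  set w := alpha a * a; have Nw : w \in <[a]> by rewrite groupM ?cycle_id.
  have [w1|w1] := eqVneq w 1.
    by apply/eqP; rewrite eq_mulgV1 invgK -/w w1.
  have ow : #[w] = p by apply: nt_prime_order => //; apply: powp.
  have alphaw : alpha w = w.
    rewrite autM // alphaK.
    by apply: (centsP (cycle_abelian a)); rewrite ?cycle_id.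
  have aw : a \in <[w]>.
    have -> : <[w]> = <[a]>; last exact: cycle_id.
    by apply/eqP; rewrite eqEcard cycle_subG Nw -!orderE oa ow leqnn.
  have fixN x : x \in <[a]> -> alpha x = x.
    move=> /cycleP[j ->]; have /cycleP[i ->] := aw.
    by rewrite !autX // alphaw.
  case/eqP: n1; apply/permP=> x; rewrite perm1.
  have [/fixN //|Nx] := boolP (x \in <[a]>).
  have Nax : alpha x \notin <[a]>.
    by apply: contra Nx => /NalphaN; rewrite alphaK.
  (* Applying [alpha] twice to [x] gives [x = x * z ^+ 2]; as [z] lies in a group of odd order,
     [z = 1] and [alpha] fixes [x] too. *)
  set z := x^-1 * alpha x; have Nz : z \in <[a]> by apply: index2_divl.
  have xz : alpha x = x * z by rewrite mulKVg.
  have zz : z ^+ 2 = 1.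
    apply: (mulgI x); rewrite expgS expg1 mulgA -xz -{1}(fixN z) //.
    by rewrite -autM // -xz alphaK mulg1.
  have [k zk] := sqr_root z (powp z Nz).
  by rewrite xz zk expgAC zz expg1n mulg1.
exists a; split=> // x Nx.
(* With [y = x ^+ k] in [<[a]>] inverted by [alpha], the square [x = y ^+ 2] equals
   [alpha y^-1 * y]. *)
have [k ->] := sqr_root x (powp x Nx).
have {Nx} : x ^+ k \in <[a]> by rewrite groupX.
case/cycleP=> i xi; have := irrS (x ^+ k).
by rewrite xi autV // autX // alphaa expgVn invgK expgS expg1.
Qed.

Theorem theorem4p3 (p : nat) (hp : prime p) (gT : finGroupType)
    (hG : #|gT| = (2 * p)%N) (S : {set gT}) (alpha : {perm gT})
    (hS : gcay_admissible S alpha) :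
  is_cayley_graph (gcay S alpha).
Proof.
have [alpha1|n1] := eqVneq alpha 1.
  rewrite alpha1 in hS *.
  by exists gT, S; split=> //; exists id => //; exists id.
have [a [oa alphaa NS]] : exists a,
    [/\ #[a] = p, alpha a = a^-1 & forall x, x \in <[a]> -> x \notin S].
  have [p2|odd_p] := even_prime hp; last exact: inverted_cycle_odd.
  by rewrite p2 in hG *; apply: inverted_cycle_order4.
by apply: inverted_cycle_cayley NS; rewrite ?oa.
Qed.
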